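(* Let $g(t)=\frac{we^{t}+1}{2}$, viewed as a formal power series in $t$. Then for all $n\ge 0$, $$E_{n+1,w}(x)=\biggl[x-\frac{g'(t)}{g(t)}\biggr]E_{n,w}(x),$$ that is, $E_{n+1,w}(x)=xE_{n,w}(x)-\frac{g'(t)}{g(t)}E_{n,w}(x)$, where $g'(t)=\frac{\mathrm{d}g(t)}{\mathrm{d}t}$ and the power series $\frac{g'(t)}{g(t)}$ acts on polynomials in $x$ as a differential operator.
   Context: Let $p$ be a fixed odd prime, $\mathbb{C}_p$ the completion of an algebraic closure of $\mathbb{Q}_p$ with absolute value normalized by $|p|_p=p^{-1}$, and let $w\in\mathbb{C}_p$ satisfy $|1-w|_p<1$. The weighted Euler polynomials $E_{n,w}(x)$ ($n\ge 0$) are defined by the formal power series identity $\frac{2}{we^t+1}e^{xt}=\sum_{n=0}^\infty E_{n,w}(x)\frac{t^n}{n!}$. A formal power series $f(t)=\sum_{k\ge 0}a_k\frac{t^k}{k!}$ with coefficients in $\mathbb{C}_p$ acts as a linear operator on polynomials $h(x)\in\mathbb{C}_p[x]$ by letting $t^k$ act as $\frac{\mathrm{d}^k}{\mathrm{d}x^k}$, i.e. $f(t)h(x)=\sum_{k\ge0}\frac{a_k}{k!}h^{(k)}(x)$ (a finite sum). The symbol $x$ in the bracket denotes multiplication by $x$. *)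

(* Defs.v *)
From HB Require Import structures.
From mathcomp Require Import all_boot all_order all_algebra.
From mathcomp Require Import boolp reals.

Set Implicit Arguments.
Unset Strict Implicit.
Unset Printing Implicit Defensive.

Import Order.TTheory GRing.Theory Num.Theory.
Local Open Scope ring_scope.

(* MathComp has no p-adic numbers.  C_p is characterized, up to isometric
   isomorphism, along its usual construction: Q_p is the completion of rat for
   the p-adic absolute value, then an algebraic closure of Q_p is taken, with
   the (unique) absolute value extending that of Q_p, and completed.          *)

Definition padic_abs (R : realType) (p : nat) (x : rat) : R :=
  if x == 0 then 0
  else p%:R ^ ((logn p `|denq x|%N)%:Z - (logn p `|numq x|%N)%:Z).

Record is_abs_value (R : realType) (K : fieldType) (abs : K -> R) : Prop := {
  abs_value_ge0 : forall x, 0 <= abs x;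
  abs_value_eq0 : forall x, abs x = 0 <-> x = 0;
  abs_valueM : forall x y, abs (x * y) = abs x * abs y;
  abs_value_ultra : forall x y, abs (x + y) <= Num.max (abs x) (abs y) }.

Definition abs_cauchy (R : realType) (K : fieldType) (abs : K -> R)
    (u : nat -> K) : Prop :=
  forall e : R, 0 < e ->
    exists N, forall m n, (N <= m)%N -> (N <= n)%N -> abs (u m - u n) < e.

Definition abs_cvg (R : realType) (K : fieldType) (abs : K -> R)
    (u : nat -> K) (l : K) : Prop :=
  forall e : R, 0 < e -> exists N, forall n, (N <= n)%N -> abs (u n - l) < e.

Record is_completion (R : realType) (K L : fieldType)
    (absK : K -> R) (absL : L -> R) (f : {rmorphism K -> L}) : Prop := {
  completion_isom : forall x, absL (f x) = absK x;
  completion_dense :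
    forall (y : L) (e : R), 0 < e -> exists x, absL (y - f x) < e;
  completion_complete :
    forall u : nat -> L, abs_cauchy absL u -> exists l, abs_cvg absL u l }.

Record is_algebraic_closure (K L : fieldType) (f : {rmorphism K -> L})
    : Prop := {
  algebraic_closure_closed : GRing.closed_field_axiom L;
  algebraic_closure_algebraic : forall y, algebraicOver f y }.

Definition is_padic_complex (R : realType) (p : nat) (Cp : fieldType)
    (abs : Cp -> R) : Prop :=
  is_abs_value abs /\
  exists (Qp Qpbar : fieldType) (absQp : Qp -> R) (absQpbar : Qpbar -> R)
         (iQ : {rmorphism rat -> Qp}) (iQp : {rmorphism Qp -> Qpbar})
         (iQpbar : {rmorphism Qpbar -> Cp}),
  [/\ is_abs_value absQp /\ is_completion (padic_abs R p) absQp iQ,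
      is_algebraic_closure iQp,
      is_abs_value absQpbar /\ (forall x, absQpbar (iQp x) = absQp x)
    & is_completion absQpbar abs iQpbar].

(* fps_coef f n is the coefficient of t^n (not of t^n / n!) in f(t). *)
Record fps (R : Type) : Type := Fps { fps_coef : nat -> R }.

Lemma fpsP (R : Type) (f g : fps R) : fps_coef f =1 fps_coef g -> f = g.
Proof. by case: f => f; case: g => g /= /funext ->. Qed.

HB.instance Definition _ (R : Type) := gen_eqMixin (fps R).
HB.instance Definition _ (R : Type) := gen_choiceMixin (fps R).

Section FpsZmodule.
Variable R : zmodType.

Definition fps_zero : fps R := Fps (fun=> 0).
Definition fps_opp (f : fps R) : fps R := Fps (fun n => - fps_coef f n).
Definition fps_add (f g : fps R) : fps R :=
  Fps (fun n => fps_coef f n + fps_coef g n).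

Fact fps_addA : associative fps_add.
Proof. by move=> f g h; apply: fpsP => n /=; rewrite addrA. Qed.
Fact fps_addC : commutative fps_add.
Proof. by move=> f g; apply: fpsP => n /=; rewrite addrC. Qed.
Fact fps_add0 : left_id fps_zero fps_add.
Proof. by move=> f; apply: fpsP => n /=; rewrite add0r. Qed.
Fact fps_addN : left_inverse fps_zero fps_opp fps_add.
Proof. by move=> f; apply: fpsP => n /=; rewrite addNr. Qed.

HB.instance Definition _ :=
  GRing.isZmodule.Build (fps R) fps_addA fps_addC fps_add0 fps_addN.

Lemma fps_coef0 n : fps_coef (0 : fps R) n = 0. Proof. by []. Qed.
Lemma fps_coefN (f : fps R) n : fps_coef (- f) n = - fps_coef f n.
Proof. by []. Qed.
Lemma fps_coefD (f g : fps R) n :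
  fps_coef (f + g) n = fps_coef f n + fps_coef g n.
Proof. by []. Qed.
Lemma fps_coefB (f g : fps R) n :
  fps_coef (f - g) n = fps_coef f n - fps_coef g n.
Proof. by []. Qed.
Lemma fps_coef_sum I (r : seq I) (P : pred I) (F : I -> fps R) n :
  fps_coef (\sum_(i <- r | P i) F i) n = \sum_(i <- r | P i) fps_coef (F i) n.
Proof.
exact: (big_morph (fun f : fps R => fps_coef f n)
                  (fun f g => fps_coefD f g n) (fps_coef0 n)).
Qed.
End FpsZmodule.

Section FpsRing.
Variable R : comNzRingType.
Implicit Types f g h : fps R.

Definition fps_const (c : R) : fps R := Fps (fun n => if n == 0%N then c else 0).
Definition fps_mul f g : fps R :=
  Fps (fun n => \sum_(i < n.+1) fps_coef f i * fps_coef g (n - i)).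

Let trunc N f : {poly R} := \poly_(i < N.+1) fps_coef f i.

Let coef_trunc N f n : (n <= N)%N -> (trunc N f)`_n = fps_coef f n.
Proof. by rewrite coef_poly ltnS => ->. Qed.

Let fps_mul_poly f g n (P Q : {poly R}) :
    (forall i, (i <= n)%N -> P`_i = fps_coef f i) ->
    (forall i, (i <= n)%N -> Q`_i = fps_coef g i) ->
  fps_coef (fps_mul f g) n = (P * Q)`_n.
Proof.
move=> hP hQ; rewrite coefM /=; apply: eq_bigr => i _.
have lein : (i <= n)%N by rewrite -ltnS.
by rewrite hP ?hQ ?leq_subr.
Qed.

Let coef_truncM N f g i : (i <= N)%N ->
  (trunc N f * trunc N g)`_i = fps_coef (fps_mul f g) i.
Proof.
move=> iN; symmetry.
by apply: fps_mul_poly => j ji; rewrite coef_trunc ?(leq_trans ji).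
Qed.

Fact fps_mulA : associative fps_mul.
Proof.
move=> f g h; apply: fpsP => n.
rewrite (@fps_mul_poly f _ n (trunc n f) (trunc n g * trunc n h)).
- rewrite mulrA; symmetry; apply: fps_mul_poly => i ni.
    exact: coef_truncM.
  exact: coef_trunc.
- by move=> i ni; rewrite coef_trunc.
by move=> i ni; rewrite coef_truncM.
Qed.

Fact fps_mulC : commutative fps_mul.
Proof.
move=> f g; apply: fpsP => n.
by rewrite -(coef_truncM f g (leqnn n)) mulrC coef_truncM.
Qed.

Fact fps_mul1 : left_id (fps_const 1) fps_mul.
Proof.
move=> f; apply: fpsP => n /=.
rewrite big_ord_recl /= subn0 mul1r big1 ?addr0 // => i _.
by rewrite mul0r.
Qed.

Fact fps_mulDl : left_distributive fps_mul +%R.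
Proof.
move=> f g h; apply: fpsP => n /=.
by rewrite -big_split; apply: eq_bigr => i _ /=; rewrite mulrDl.
Qed.

Fact fps_1_neq0 : fps_const 1 != 0.
Proof.
by apply/eqP => /(congr1 (fun f => fps_coef f 0))/eqP /=; rewrite oner_eq0.
Qed.

HB.instance Definition _ := GRing.Zmodule_isComNzRing.Build (fps R)
  fps_mulA fps_mulC fps_mul1 fps_mulDl fps_1_neq0.

Lemma fps_coef1 n : fps_coef (1 : fps R) n = if n == 0%N then 1 else 0.
Proof. by []. Qed.
Lemma fps_coefM f g n :
  fps_coef (f * g) n = \sum_(i < n.+1) fps_coef f i * fps_coef g (n - i).
Proof. by []. Qed.
Lemma fps_coefM0 f g : fps_coef (f * g) 0 = fps_coef f 0 * fps_coef g 0.
Proof. by rewrite fps_coefM big_ord1. Qed.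
Lemma fps_coefCM c f n : fps_coef (fps_const c * f) n = c * fps_coef f n.
Proof.
rewrite fps_coefM big_ord_recl /= subn0 big1 ?addr0 // => i _.
by rewrite mul0r.
Qed.

Lemma fps_coefX_small f n k :
  fps_coef f 0 = 0 -> (n < k)%N -> fps_coef (f ^+ k) n = 0.
Proof.
move=> f0; elim: k n => // k IHk n; rewrite ltnS => nk.
rewrite exprS fps_coefM big1 // => -[[|i] /= lei] _; first by rewrite f0 mul0r.
rewrite IHk ?mulr0 //; apply: leq_trans nk; rewrite ltn_subrL.
by case: n lei.
Qed.

Definition fps_deriv f : fps R := Fps (fun n => fps_coef f n.+1 *+ n.+1).

(* The differential operator f(d/dx): t^k acts as the k-th derivative, which
   kills h for k >= size h. *)
Definition fps_act f (h : {poly R}) : {poly R} :=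
  \sum_(k < size h) fps_coef f k *: h^`(k).
End FpsRing.

Section FpsUnitRing.
Variable R : comUnitRingType.
Implicit Types f g : fps R.

Definition fps_unit : {pred fps R} := [pred f | fps_coef f 0 \is a GRing.unit].

(* With a the constant coefficient of f, the inverse is the geometric series
   a^-1 * \sum_k (1 - f / a) ^+ k; only k <= n contributes to degree n. *)
Definition fps_inv f : fps R :=
  let c := fps_const (fps_coef f 0)^-1 in
  if f \in fps_unit then
    Fps (fun n => fps_coef (c * \sum_(k < n.+1) (1 - c * f) ^+ k) n)
  else f.

Fact fps_mulVf : {in fps_unit, left_inverse 1 fps_inv *%R}.
Proof.
move=> f fU; apply: fpsP => n; rewrite /fps_inv fU.
set c := fps_const _; set u := 1 - c * f.
have u0 : fps_coef u 0 = 0.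
  by rewrite fps_coefB fps_coefCM mulVr // fps_coef1 subrr.
have -> : fps_coef
    (Fps (fun n => fps_coef (c * \sum_(k < n.+1) u ^+ k) n) * f) n
    = fps_coef ((c * \sum_(k < n.+1) u ^+ k) * f) n.
  rewrite !fps_coefM; apply: eq_bigr => i _; congr (_ * _) => /=.
  rewrite -[X in X = _]/(fps_coef (c * _) i) -[X in _ = X]/(fps_coef (c * _) i).
  rewrite !fps_coefCM !fps_coef_sum; congr (_ * _).
  have le_in : (i.+1 <= n.+1)%N := ltn_ord i.
  rewrite (big_ord_widen n.+1 (fun k => fps_coef (u ^+ k) i) le_in).
  rewrite big_mkcond; apply: eq_bigr => k _.
  by rewrite ltnS; case: leqP => // ik; rewrite fps_coefX_small.
have -> : c * (\sum_(k < n.+1) u ^+ k) * f = 1 - u ^+ n.+1.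
  have -> : c * (\sum_(k < n.+1) u ^+ k) * f
            = (1 - u) * \sum_(k < n.+1) u ^+ k.
    by rewrite /u subKr mulrAC.
  rewrite -[X in _ = X - _](expr1n _ n.+1) subrXX; congr (_ * _).
  by apply: eq_bigr => k _; rewrite expr1n mul1r.
by rewrite fps_coefB (fps_coefX_small u0) // subr0.
Qed.

Fact fps_unitPl f g : g * f = 1 -> f \in fps_unit.
Proof.
move=> gf1; apply/unitrPr; exists (fps_coef g 0).
by rewrite mulrC -fps_coefM0 gf1.
Qed.

Fact fps_inv_out : {in [predC fps_unit], fps_inv =1 id}.
Proof. by move=> f /negbTE; rewrite /fps_inv => ->. Qed.

HB.instance Definition _ := GRing.ComNzRing_hasMulInverse.Build (fps R)
  fps_mulVf fps_unitPl fps_inv_out.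

Lemma fps_unitE f : (f \is a GRing.unit) = (fps_coef f 0 \is a GRing.unit).
Proof. by []. Qed.

(* e^{a t} *)
Definition fps_exp (a : R) : fps R := Fps (fun n => a ^+ n / n`!%:R).

(* \sum_n E_n t^n / n! *)
Definition fps_egf (E : nat -> R) : fps R := Fps (fun n => E n / n`!%:R).
End FpsUnitRing.

(* E is the sequence of weighted Euler polynomials of weight w; the identity
   lives in K[x][[t]], whose coefficient ring is {poly K} with x = 'X. *)
Definition is_weighted_euler (K : fieldType) (w : K) (E : nat -> {poly K})
    : Prop :=
  2 / (fps_const w%:P * fps_exp 1 + 1) * fps_exp 'X = fps_egf E.

Lemma is_weighted_euler_exists (K : fieldType) (w : K) :
  [pchar K] =i pred0 -> exists E, is_weighted_euler w E.
Proof.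
move=> /pcharf0P charK.
set F := 2 / (fps_const w%:P * fps_exp 1 + 1) * fps_exp 'X.
exists (fun n => fps_coef F n * n`!%:R); apply: fpsP => n /=.
by rewrite -/F mulrK // -polyC_natr poly_unitE coefC size_polyC unitfE charK -lt0n fact_gt0.
Qed.

(* Main.v *)
(* In K[x][[t]] put F = e^{xt} / g(t), so that F = \sum_n E_n t^n / n!.
   Differentiating F g = e^{xt} in t gives F' = (x - g'/g) F, which is the
   recurrence on coefficients once multiplication by q(t) is identified with
   the action of q(d/dx); that holds because (d/dx) F = t F.  Finally g is
   invertible because w + 1 != 0: if w = -1 then |1 - w| = |2| = 1, p being
   odd. *)
From HB Require Import structures.
Require Import Defs.
From mathcomp Require Import all_boot all_order all_algebra.
From mathcomp Require Import boolp reals.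

Set Implicit Arguments.
Unset Strict Implicit.

Import Order.TTheory GRing.Theory Num.Theory.
Local Open Scope ring_scope.

Section FpsMap.
Variables (R S : comNzRingType) (phi : {rmorphism R -> S}).

(** With [phi := polyC] this carries series with scalar coefficients, such as g, into K[x][[t]],
    where the generating function lives. *)
Definition fps_map (f : fps R) : fps S := Fps (fun n => phi (fps_coef f n)).

Fact fps_map_zmod_morphism : zmod_morphism fps_map.
Proof. by move=> f g; apply: fpsP => n /=; rewrite rmorphB. Qed.

Fact fps_map_monoid_morphism : monoid_morphism fps_map.
Proof.
split=> [|f g]; apply: fpsP => n /=.
  by case: ifP; rewrite ?rmorph1 ?rmorph0.
by rewrite rmorph_sum; apply: eq_bigr => i _; rewrite rmorphM.
Qed.

HB.instance Definition _ :=
  GRing.isZmodMorphism.Build (fps R) (fps S) fps_map fps_map_zmod_morphism.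
HB.instance Definition _ :=
  GRing.isMonoidMorphism.Build (fps R) (fps S) fps_map fps_map_monoid_morphism.

Lemma fps_map_const c : fps_map (fps_const c) = fps_const (phi c).
Proof. by apply: fpsP => n /=; case: ifP; rewrite ?rmorph0. Qed.

Lemma fps_deriv_map f : fps_deriv (fps_map f) = fps_map (fps_deriv f).
Proof. by apply: fpsP => n /=; rewrite rmorphMn. Qed.

End FpsMap.

Lemma fps_derivM (R : comNzRingType) (f g : fps R) :
  fps_deriv (f * g) = fps_deriv f * g + f * fps_deriv g.
Proof.
apply: fpsP => n.
rewrite -[LHS]/(fps_coef (f * g) n.+1 *+ n.+1) fps_coefM.
(* Split the factor n + 1 as i + (n + 1 - i); the first weight vanishes at i = 0, the second at i =
   n + 1. *)
have -> : (\sum_(i < n.+2) fps_coef f i * fps_coef g (n.+1 - i)) *+ n.+1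
  = \sum_(i < n.+2) (fps_coef f i *+ i * fps_coef g (n.+1 - i)
                     + fps_coef f i * (fps_coef g (n.+1 - i) *+ (n.+1 - i))).
  rewrite -sumrMnl; apply: eq_bigr => i _.
  by rewrite mulrnAl mulrnAr -mulrnDr subnKC // -ltnS.
rewrite fps_coefD !fps_coefM big_split /=; congr (_ + _).
  by rewrite big_ord_recl mulr0n mul0r add0r; apply: eq_bigr.
rewrite big_ord_recr /= subnn mulr0n mulr0 addr0; apply: eq_bigr => i _.
by rewrite subSn // -ltnS.
Qed.

Section FpsExp.
Variable R : comUnitRingType.
Hypothesis fact_unit : forall n, n`!%:R \is a @GRing.unit R.

(** Invertible factorials are assumed outright because the coefficient ring will be K[x], which is
    not a field. *)
Lemma fps_deriv_exp (a : R) :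
  fps_deriv (fps_exp a) = fps_const a * fps_exp a.
Proof.
apply: fpsP => n; rewrite fps_coefCM /= exprS -mulrnAr -!mulrA; congr (_ * _).
congr (_ * _); rewrite -mulr_natr factS natrM.
have nU : n.+1%:R \is a @GRing.unit R.
  by move: (fact_unit n.+1); rewrite factS natrM unitrM => /andP[].
by rewrite invrM // mulrVK.
Qed.

Lemma fps_map_exp (S : comUnitRingType) (phi : {rmorphism R -> S}) (a : R) :
  fps_map phi (fps_exp a) = fps_exp (phi a).
Proof.
by apply: fpsP => n /=; rewrite rmorphM rmorphXn rmorphV // rmorph_nat.
Qed.

End FpsExp.

(** Derivatives of order at least [size h] vanish; a free bound [N] lets sums with different cutoffs
    be compared. *)
Lemma fps_act_widen (R : comNzRingType) (f : fps R) (h : {poly R}) N :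
  (size h <= N)%N -> fps_act f h = \sum_(k < N) fps_coef f k *: h^`(k).
Proof.
move=> leN; rewrite /fps_act (big_ord_widen N (fun k => fps_coef f k *: h^`(k)) leN).
rewrite big_mkcond.
apply: eq_bigr => k _ /=; case: ltnP => // lek.
by rewrite derivn_poly0 // scaler0.
Qed.

Lemma fps_actMn (R : comNzRingType) (f : fps R) (h : {poly R}) m :
  fps_act f (h *+ m) = fps_act f h *+ m.
Proof.
have le : (size (h *+ m) <= size h)%N.
  apply/leq_sizeP => j lej; rewrite coefMn (nth_default _ lej); exact: mul0rn.
rewrite (fps_act_widen _ le) -sumrMnl; apply: eq_bigr => k _.
by rewrite derivnMn scalerMnr.
Qed.

(* [deriv F_(n+1) = F_n] says that d/dx acts on F as multiplication by t. *)
Lemma fps_act_coef (R : comNzRingType) (f : fps R) (F : fps {poly R}) n :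
    (fps_coef F 0)^`() = 0 ->
    (forall m, (fps_coef F m.+1)^`() = fps_coef F m) ->
  fps_act f (fps_coef F n) = fps_coef (fps_map polyC f * F) n.
Proof.
move=> F0 FS.
have derivnF k m : (k <= m)%N -> (fps_coef F m)^`(k) = fps_coef F (m - k).
  elim: k => [|k IHk] ltkm; first by rewrite subn0.
  by rewrite derivnS IHk 1?ltnW // -(subnSK ltkm) FS.
(* Both sums are extended to the common bound max(n + 1, size F_n) and compared term by term. *)
rewrite (fps_act_widen _ (leq_maxr n.+1 _)) fps_coefM.
rewrite (big_ord_widen _ (fun i => fps_coef (fps_map polyC f) i
  * fps_coef F (n - i)) (leq_maxl n.+1 (size (fps_coef F n)))).
rewrite [RHS]big_mkcond; apply: eq_bigr => k _; rewrite ltnS /=.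
case: leqP => [lekn|ltnk]; first by rewrite derivnF // mul_polyC.
(* For k > n the k-th derivative of F_n factors through its (n + 1)-st, which is the derivative of
   F_0, hence zero. *)
rewrite -(subnK ltnk) /derivn iterD -!/(derivn _ _) derivnS derivnF //.
by rewrite subnn F0 linear0 scaler0.
Qed.

Section CharZero.
Variable K : fieldType.
Hypothesis charK : [pchar K] =i pred0.

Lemma natf_unit n : n.+1%:R \is a @GRing.unit K.
Proof. by rewrite unitfE ((pcharf0P K).1 charK). Qed.

Lemma fact_unit_field n : n`!%:R \is a @GRing.unit K.
Proof. by rewrite -(prednK (fact_gt0 n)) natf_unit. Qed.

Lemma fact_unit_poly n : n`!%:R \is a @GRing.unit {poly K}.
Proof. by rewrite -(rmorph_nat polyC) rmorph_unit ?fact_unit_field. Qed.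

(** Coefficient form of (d/dx) e^{xt} = t e^{xt}. *)
Lemma deriv_fps_exp_X n :
  (fps_coef (fps_exp ('X : {poly K})) n.+1)^`() = fps_coef (fps_exp 'X) n.
Proof.
have expXE m : fps_coef (fps_exp ('X : {poly K})) m = (m`!%:R^-1)%:P * 'X^m.
  by rewrite /= -(rmorph_nat polyC) -rmorphV ?fact_unit_field // mulrC.
rewrite !expXE deriv_mulC derivXn /= mulrnAr -mulrnAl; congr (_ * _).
rewrite -polyCMn factS natrM -(mulr_natr _^-1); congr (_%:P).
by rewrite invrM ?natf_unit ?fact_unit_field // mulrVK ?natf_unit.
Qed.

Lemma deriv_fps_map_exp_X (c : fps K) n :
  (fps_coef (fps_map polyC c * fps_exp 'X) n.+1)^`()
  = fps_coef (fps_map polyC c * fps_exp 'X) n.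
Proof.
(* The last term of the Cauchy product is a scalar, so d/dx kills it; in the others d/dx acts on the
   exponential factor only. *)
rewrite !fps_coefM linear_sum /= big_ord_recr /= subnn expr0 fact0 divr1.
rewrite mulr1 derivC addr0; apply: eq_bigr => i _.
rewrite deriv_mulC subSn; last by rewrite -ltnS.
by rewrite -[_ / _]/(fps_coef (fps_exp 'X) (n - i).+1) deriv_fps_exp_X.
Qed.

(** The purely algebraic content: the p-adic hypotheses enter only through characteristic zero and w
    + 1 != 0, the latter making g(0) invertible. *)
Lemma weighted_euler_recurrence (w : K) (E : nat -> {poly K}) :
    w + 1 != 0 -> is_weighted_euler w E ->
  let g : fps K := (fps_const w * fps_exp 1 + 1) / 2 in
  forall n, E n.+1 = 'X * E n - fps_act (fps_deriv g / g) (E n).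
Proof.
move=> w1 EP g n; set q := fps_deriv g / g.
pose d : fps K := fps_const w * fps_exp 1 + 1.
have dU : d \is a GRing.unit.
  by rewrite fps_unitE fps_coefD fps_coefCM /= expr0 fact0 divr1 mulr1 unitfE.
have twoU : 2 \is a @GRing.unit (fps K).
  by rewrite fps_unitE; exact: (natf_unit 1).
have gU : g \is a GRing.unit by rewrite unitrMl // unitrV.
pose F : fps {poly K} := fps_map polyC g^-1 * fps_exp 'X.
have FE : fps_egf E = F.
  rewrite -EP /F /g invrM ?unitrV // invrK rmorphM rmorphV //.
  rewrite rmorph_nat rmorphD rmorphM rmorph1 /= fps_map_const.
  by rewrite (fps_map_exp fact_unit_field) rmorph1.
have EF m : E m = fps_coef F m *+ m`!.
  by rewrite -FE /= -[RHS]mulr_natr mulrVK ?fact_unit_poly.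
have FG : F * fps_map polyC g = fps_exp 'X.
  by rewrite /F mulrAC -rmorphM mulVr // rmorph1 mul1r.
have dF : fps_deriv F = fps_const 'X * F - fps_map polyC q * F.
  (* After multiplication by g, both sides are read off from the product rule for F g = e^{xt}. *)
  apply: (mulIr (rmorph_unit (fps_map polyC) gU)).
  rewrite mulrBl -[X in X - _]mulrA FG -(fps_deriv_exp fact_unit_poly) -FG.
  rewrite (fps_derivM F) fps_deriv_map [X in _ - X]mulrAC -rmorphM divrK //.
  by rewrite [fps_map _ _ * F]mulrC addrK.
have F0 : (fps_coef F 0)^`() = 0.
  by rewrite fps_coefM0 /= expr0 fact0 divr1 mulr1 derivC.
rewrite !EF fps_actMn (fps_act_coef _ _ F0 (deriv_fps_map_exp_X _)).
(* (n + 1)! F_(n+1) is n! times (n + 1) F_(n+1), the n-th coefficient of F'. *)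
rewrite factS mulrnA -[_ *+ n.+1]/(fps_coef (fps_deriv F) n) dF.
by rewrite fps_coefB fps_coefCM mulrnBl mulrnAr.
Qed.

End CharZero.

(** Each embedding in the tower from Q through Q_p and its closure to C_p preserves absolute values,
    hence so does the composite. *)
Lemma padic_complex_rat (R : realType) (p : nat) (Cp : fieldType)
    (abs : Cp -> R) :
  is_padic_complex p abs ->
  exists f : {rmorphism rat -> Cp}, forall x, abs (f x) = padic_abs R p x.
Proof.
case=> _ [Qp [Qb [aQ [aQb [iQ [iQp [iQb [[_ cQ] _ [_ aE] cC]]]]]]]].
exists (iQb \o (iQp \o iQ)) => x /=.
by rewrite (completion_isom cC) aE (completion_isom cQ).
Qed.

Lemma padic_abs2 (R : realType) (p : nat) :
  prime p -> odd p -> padic_abs R p 2 = 1.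
Proof.
move=> pp po; rewrite /padic_abs /= logn1 (logn_prime p (isT : prime 2)).
by case: eqP po => [->|].
Qed.

Unset Implicit Arguments.
Set Strict Implicit.

Theorem theorem2p2 (R : realType) (p : nat) (p_prime : prime p) (p_odd : odd p)
    (Cp : fieldType) (abs : Cp -> R) (CpP : is_padic_complex p abs)
    (w : Cp) (w1 : abs (1 - w) < 1)
    (E : nat -> {poly Cp}) (EP : is_weighted_euler w E) :
  let g : fps Cp := (fps_const w * fps_exp 1 + 1) / 2 in
  forall n : nat, E n.+1 = 'X * E n - fps_act (fps_deriv g / g) (E n).
Proof.
have [f absf] := padic_complex_rat CpP.
apply: weighted_euler_recurrence EP => [|].
  (* A field morphism preserves the characteristic, so [Cp] inherits characteristic zero from
     [rat]. *)
  by move=> q; rewrite (fmorph_pchar f) pchar_num.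
apply: contraTneq w1 => /eqP; rewrite addr_eq0 => /eqP ->.
by rewrite opprK -[1 + 1]/(2%:R) -(rmorph_nat f 2) absf padic_abs2 // ltxx.
Qed.
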